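(* Let $G$ be a connected (crown, fork)-free graph that contains an induced subgraph $Q$ isomorphic to $K_{1,3}$, and let $v$ be the vertex of degree $3$ in $Q$. Then $G[M(v)]$ is perfect.
   Context: All graphs are finite and simple. For a vertex $v$ of $G$, $N(v)$ is the set of vertices adjacent to $v$, and $M(v)=V(G)\setminus (N(v)\cup\{v\})$ is the set of non-neighbors of $v$ other than $v$. $G[X]$ is the subgraph of $G$ induced by $X\subseteq V(G)$. A graph is perfect if $\chi(F)=\omega(F)$ for each of its induced subgraphs $F$, where $\chi$ is the chromatic number and $\omega$ the clique number. The crown is the graph $K_1+K_{1,3}$, i.e. the claw $K_{1,3}$ together with a new vertex adjacent to all four vertices of $K_{1,3}$. The fork is the graph obtained from $K_{1,3}$ by subdividing one edge once. A graph is $(F_1,F_2)$-free if it has no induced subgraph isomorphic to $F_1$ or to $F_2$. *)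

(* Defs.v *)
From mathcomp Require Import all_boot.

Set Implicit Arguments.
Unset Strict Implicit.
Unset Printing Implicit Defensive.

Record sgraph := SGraph {
  vertex :> finType;
  adj : rel vertex;
  adj_sym : symmetric adj;
  adj_irr : irreflexive adj }.

Definition neighbors (G : sgraph) (x : G) : {set G} := [set y | adj x y].

Definition nonneighbors (G : sgraph) (x : G) : {set G} :=
  ~: (neighbors x :|: [set x]).

Definition degree (G : sgraph) (x : G) : nat := #|neighbors x|.

Definition connected (G : sgraph) : Prop :=
  forall x y : G, connect (@adj G) x y.

Section Induced.
Variables (G : sgraph) (X : {set G}).

Definition induced_vertex : finType := {x : G | x \in X}.

Definition induced_adj : rel induced_vertex := fun x y => adj (val x) (val y).

Lemma induced_adj_sym : symmetric induced_adj.
Proof. by move=> x y; apply: adj_sym. Qed.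

Lemma induced_adj_irr : irreflexive induced_adj.
Proof. by move=> x; apply: adj_irr. Qed.

Definition induced : sgraph := SGraph induced_adj_sym induced_adj_irr.

End Induced.

Definition isomorphic (G H : sgraph) : Prop :=
  exists2 f : G -> H, bijective f & forall x y, adj (f x) (f y) = adj x y.

Definition free (F G : sgraph) : Prop :=
  ~ exists X : {set G}, isomorphic (induced X) F.

Definition clique (G : sgraph) (K : {set G}) : bool :=
  [forall x in K, forall y in K, (x != y) ==> adj x y].

Definition clique_number (G : sgraph) : nat :=
  \max_(K : {set G} | clique K) #|K|.

Definition colorable (G : sgraph) (k : nat) : bool :=
  [exists c : {ffun G -> 'I_k},
    [forall x, forall y, adj x y ==> (c x != c y)]].

Lemma colorable_ex (G : sgraph) : exists k, colorable G k.
Proof.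
exists #|G|; apply/existsP; exists [ffun x => enum_rank x].
apply/forallP=> x; apply/forallP=> y; apply/implyP=> xy.
rewrite !ffunE; apply/eqP=> /enum_rank_inj exy.
by move: xy; rewrite exy adj_irr.
Qed.

Definition chromatic_number (G : sgraph) : nat := ex_minn (colorable_ex G).

Definition perfect (G : sgraph) : Prop :=
  forall X : {set G},
    chromatic_number (induced X) = clique_number (induced X).

Section CompleteGraph.
Variable n : nat.

Definition complete_adj : rel 'I_n := fun i j => i != j.

Lemma complete_adj_sym : symmetric complete_adj.
Proof. by move=> i j; rewrite /complete_adj eq_sym. Qed.

Lemma complete_adj_irr : irreflexive complete_adj.
Proof. by move=> i; rewrite /complete_adj eqxx. Qed.

Definition complete : sgraph := SGraph complete_adj_sym complete_adj_irr.

End CompleteGraph.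

Section CompleteBipartite.
Variables m n : nat.

Definition bipartite_adj : rel ('I_m + 'I_n)%type := fun x y =>
  match x, y with
  | inl _, inr _ | inr _, inl _ => true
  | _, _ => false
  end.

Lemma bipartite_adj_sym : symmetric bipartite_adj.
Proof. by move=> [i|i] [j|j]. Qed.

Lemma bipartite_adj_irr : irreflexive bipartite_adj.
Proof. by move=> [i|i]. Qed.

Definition complete_bipartite : sgraph :=
  SGraph bipartite_adj_sym bipartite_adj_irr.

End CompleteBipartite.

Section Join.
Variables G H : sgraph.

Definition join_adj : rel (G + H)%type := fun x y =>
  match x, y with
  | inl a, inl b => adj a b
  | inr a, inr b => adj a b
  | _, _ => true
  end.

Lemma join_adj_sym : symmetric join_adj.
Proof. by move=> [a|a] [b|b] //=; apply: adj_sym. Qed.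

Lemma join_adj_irr : irreflexive join_adj.
Proof. by move=> [a|a] /=; apply: adj_irr. Qed.

Definition join : sgraph := SGraph join_adj_sym join_adj_irr.

End Join.

(* The edge ab is replaced by the path a, None, b; the construction is only
   meaningful when a and b are adjacent. *)
Section Subdivide.
Variables (G : sgraph) (a b : G).

Definition subdivide_adj : rel (option G) := fun x y =>
  match x, y with
  | Some u, Some w => adj u w && ([set u; w] != [set a; b])
  | Some u, None | None, Some u => u \in [set a; b]
  | None, None => false
  end.

Lemma subdivide_adj_sym : symmetric subdivide_adj.
Proof. by move=> [u|] [w|] //=; rewrite adj_sym setUC. Qed.

Lemma subdivide_adj_irr : irreflexive subdivide_adj.
Proof. by move=> [u|] //=; rewrite adj_irr. Qed.

Definition subdivide : sgraph := SGraph subdivide_adj_sym subdivide_adj_irr.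

End Subdivide.

Definition claw : sgraph := complete_bipartite 1 3.

Definition crown : sgraph := join (complete 1) claw.

Definition fork : sgraph :=
  @subdivide claw (inl ord0) (inr ord0).

(* Main.v *)
Require Import Defs.
From mathcomp Require Import all_boot.

(** Perfection of the graph of non-neighbours of [v] is proved without any
characterisation of perfect graphs by excluded holes and antiholes.  If some
induced subgraph of it had chromatic number larger than its clique number,
there would be an inclusion-minimal set [H] of non-neighbours with this defect
(a [critical] set).  A critical set contains no stable set meeting all of its
maximum cliques ([critical_missed]), and this has elementary consequences: it
is connected, it is not a join, it has no star cutset, and it is not the union
of two cliques.

In a fork-free graph these facts control how a critical set [H] is attached to
the rest.  If [p] has no neighbour in [H], then the neighbours in [H] of a
vertex [t] adjacent to [p] form either a clique or all of [H] ([attachment]):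
otherwise a nontrivial component of the complement of the graph they induce
would be a homogeneous set of [H], hence would give a star cutset or a join.

Let [a], [b], [c] be the leaves of the claw with centre [v].  By
fork-freeness, a non-neighbour of [v] adjacent to one leaf is adjacent to two.

If [H] had no vertex at distance two from [v], then, since no vertex is at
distance four from [v], some vertex [w] at distance two from [v] would be
complete to [H] and adjacent to a neighbour [p] of [v]; two non-adjacent
vertices of [H] together with [w], [p] and [v] then form a fork
([critical_not_far]).  So some neighbour [t] of [v] has a neighbour in [H].

No neighbour of [v] is complete to [H], since this property would spread to
the leaves of the claw and produce a crown ([neighbour_not_complete]).  So
every neighbour of [v] meets [H] in a clique.  The vertices of [H] adjacent to
a leaf of the claw then pairwise share a leaf, so they form a clique; absence
of star cutsets and of forks shows that the other vertices of [H] form a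
clique too, and [H] is the union of two cliques, a contradiction
([near_contradiction]). *)

Set Implicit Arguments.
Unset Strict Implicit.
Unset Printing Implicit Defensive.

(** * Cliques and colourings of vertex sets *)

Section Colouring.
Variable G : sgraph.
Implicit Types (A B H K P Q S X Y : {set G}) (x y w : G).

Lemma cliqueP K :
  reflect {in K &, forall x y, x != y -> adj x y} (clique K).
Proof.
apply: (iffP forall_inP) => [cl x y xK yK|cl x xK].
  by move/forall_inP: (cl x xK) => /(_ y yK)/implyP.
by apply/forall_inP=> y yK; apply/implyP; apply: cl.
Qed.

Lemma not_clique X : ~~ clique X ->
  exists x y, [/\ x \in X, y \in X, x != y & ~~ adj x y].
Proof.
rewrite negb_forall => /existsP[x]; rewrite negb_imply => /andP[xX].
rewrite negb_forall => /existsP[y]; rewrite negb_imply => /andP[yX].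
by rewrite negb_imply => /andP[xy nxy]; exists x, y.
Qed.

Lemma clique_sub K X : K \subset X -> clique X -> clique K.
Proof.
move=> /subsetP KX /cliqueP cX; apply/cliqueP=> x y /KX xX /KX yX.
exact: cX.
Qed.

Definition omega X : nat := \max_(K : {set G} | (K \subset X) && clique K) #|K|.

Lemma clique_le_omega K X : K \subset X -> clique K -> #|K| <= omega X.
Proof.
move=> KX cK; rewrite /omega.
apply: (@leq_bigmax_cond _ (fun K => (K \subset X) && clique K)
  (fun K : {set G} => #|K|)).
by rewrite KX.
Qed.

Lemma omega_le X k :
  (forall K, K \subset X -> clique K -> #|K| <= k) -> omega X <= k.
Proof. by move=> h; apply/bigmax_leqP=> K /andP[]; apply: h. Qed.

Lemma omega_attained X : exists K, [/\ K \subset X, clique K & #|K| = omega X].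
Proof.
have c0 : (set0 \subset X) && clique (set0 : {set G}).
  by rewrite sub0set; apply/cliqueP=> x y; rewrite inE.
have : 0 < #|[pred K : {set G} | (K \subset X) && clique K]|.
  by apply/card_gt0P; exists set0.
move=> /(@eq_bigmax_cond _ _ (fun K : {set G} => #|K|)) [K /andP[KX cK] eK].
by exists K; split.
Qed.

Lemma omega_sub X Y : X \subset Y -> omega X <= omega Y.
Proof.
move=> XY; apply: omega_le => K KX; apply: clique_le_omega.
exact: subset_trans KX XY.
Qed.

Definition stable S : bool := [forall x in S, forall y in S, ~~ adj x y].

Lemma stableP S : reflect {in S &, forall x y, ~~ adj x y} (stable S).
Proof.
apply: (iffP forall_inP) => [st x y xS yS|st x xS].
  by move/forall_inP: (st x xS) => /(_ y yS).
by apply/forall_inP=> y yS; apply: st.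
Qed.

(** Colourability is inherited from induced subgraphs so that it is decidable;
[colourable_setP] restates it with colours read as natural numbers, which lets
colourings be combined without casts between ordinal types. *)
Definition colourable_set X k : bool := colorable (induced X) k.

Lemma colourable_setP X k :
  reflect (exists2 c : G -> nat, {in X, forall x, c x < k}
            & {in X &, forall x y, adj x y -> c x != c y})
          (colourable_set X k).
Proof.
apply: (iffP existsP) => [[c /forallP cP]|[c ck cP]].
  pose d x := if insub x is Some u then val (c u) else 0.
  have dE (u : induced X) : d (val u) = val (c u) by rewrite /d valK.
  exists d => [x xX|x y xX yX xy].
    by rewrite (dE (Sub x xX)) ltn_ord.
  rewrite (dE (Sub x xX)) (dE (Sub y yX)).
  by move/forallP: (cP (Sub x xX)) => /(_ (Sub y yX))/implyP; apply.
exists [ffun u : induced X => Ordinal (ck _ (valP u))].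
apply/forallP=> u; apply/forallP=> u'; apply/implyP=> uu'.
by rewrite !ffunE; apply: cP uu'; apply: valP.
Qed.

Lemma colourable_leq X k l : k <= l -> colourable_set X k -> colourable_set X l.
Proof.
move=> kl /colourable_setP[c ck cP]; apply/colourable_setP; exists c => //.
by move=> x /ck ckx; apply: leq_trans kl.
Qed.

Lemma colourable_union X Y k l :
  colourable_set X k -> colourable_set Y l -> colourable_set (X :|: Y) (k + l).
Proof.
move=> /colourable_setP[c ck cP] /colourable_setP[d dl dP].
apply/colourable_setP; exists (fun x => if x \in X then c x else k + d x).
  move=> x; rewrite inE; case: ifP => [xX _|_ /= xY].
    by apply: leq_trans (ck x xX) (leq_addr _ _).
  by rewrite ltn_add2l dl.
move=> x y; rewrite !inE; case: ifP => xX; case: ifP => yX //=.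
- by move=> _ _; apply: cP.
- move=> _ yY _; rewrite ltn_eqF //.
  by apply: leq_trans (ck x xX) (leq_addr _ _).
- move=> xY _ _; rewrite gtn_eqF //.
  by apply: leq_trans (ck y yX) (leq_addr _ _).
- by move=> xY yY xy; rewrite eqn_add2l dP.
Qed.

Lemma colourable_stable S : stable S -> colourable_set S 1.
Proof.
move=> /stableP st; apply/colourable_setP; exists (fun=> 0) => // x y xS yS.
by rewrite (negbTE (st _ _ xS yS)).
Qed.

Lemma colourable_card X : colourable_set X #|X|.
Proof.
apply/colourable_setP; exists (index^~ (enum X)) => [x xX|x y xX yX xy].
  by rewrite cardE index_mem mem_enum.
apply: contraTneq xy => exy.
suff -> : x = y by rewrite adj_irr.
by rewrite -(nth_index x (s := enum X) (x := x)) ?mem_enum // exy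
  nth_index ?mem_enum.
Qed.

(** A clique with as many vertices as there are colours uses every colour, so
each single colour class meets it. *)
Lemma colour_class X k w : colourable_set X k -> w \in X ->
  exists S, [/\ S \subset X, stable S, w \in S &
    forall K, K \subset X -> clique K -> k <= #|K| -> ~~ [disjoint K & S]].
Proof.
move=> /colourable_setP[c ck cP] wX; exists [set x in X | c x == c w].
split.
- by apply/subsetP=> x; rewrite inE => /andP[].
- apply/stableP=> x y; rewrite !inE => /andP[xX /eqP cx] /andP[yX /eqP cy].
  by apply/negP=> /(cP _ _ xX yX); rewrite cx cy eqxx.
- by rewrite inE wX eqxx.
move=> K /subsetP KX /cliqueP cK leK.
have inj : {in enum K &, injective c}.
  move=> x y; rewrite !mem_enum => xK yK exy; apply: contraTeq isT => xy.
  by have := cP _ _ (KX _ xK) (KX _ yK) (cK _ _ xK yK xy); rewrite exy eqxx.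
have un : uniq (map c (enum K)) by rewrite map_inj_in_uniq // enum_uniq.
have sub : {subset map c (enum K) <= iota 0 k}.
  by move=> _ /mapP[x xK ->]; rewrite mem_iota /= ck // KX // -mem_enum.
have [] := uniq_min_size un sub; first by rewrite size_iota size_map -cardE.
move=> _ /(_ (c w)); rewrite mem_iota /= add0n ck // => /mapP[x xK cwx].
rewrite mem_enum in xK.
by apply/pred0Pn; exists x; rewrite /= xK inE KX // cwx eqxx.
Qed.

(** * Minimal sets violating the equality of chromatic and clique number *)

Definition tight X : bool := colourable_set X (omega X).

Definition critical H : bool :=
  ~~ tight H && [forall Y : {set G}, (Y \proper H) ==> tight Y].

Lemma critical_exists X : ~~ tight X -> exists2 H : {set G}, H \subset X & critical H.
Proof.
move=> nX; have [H /minsetP[nH minH] HX] := minset_exists (P := fun Y => ~~ tight Y) nX.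
exists H => //; rewrite /critical nH; apply/forallP=> Y; apply/implyP=> YH.
apply: contraT => nY.
by have := YH; rewrite (minH Y nY (proper_sub YH)) properxx.
Qed.

Section Critical.
Variable H : {set G}.
Hypothesis critH : critical H.

Lemma critical_proper Y : Y \proper H -> tight Y.
Proof. by case/andP: critH => _ /forallP/(_ Y)/implyP. Qed.

Lemma critical_colours k : colourable_set H k -> omega H < k.
Proof.
move=> ck; rewrite ltnNge; apply: contraTN critH => le.
by rewrite /critical negb_and negbK /tight (colourable_leq le ck).
Qed.

Lemma critical_cover A B :
  A \proper H -> B \proper H -> A :|: B = H -> omega H < omega A + omega B.
Proof.
move=> /critical_proper tA /critical_proper tB eH; apply: critical_colours.
by rewrite -eH; apply: colourable_union.
Qed.

(** Removing a stable set that meets all the maximum cliques of [H] would lower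
the clique number, and by minimality one more colour than needed by the rest
would then suffice for [H]. *)
Lemma critical_missed S : S \subset H -> stable S ->
  exists K, [/\ K \subset H, clique K, #|K| = omega H & [disjoint K & S]].
Proof.
move=> SH stS.
case: (boolP [exists K : {set G}, [&& K \subset H, clique K,
         #|K| == omega H & [disjoint K & S]]]).
  by case/existsP=> K /and4P[KH cK /eqP oK dK]; exists K.
rewrite negb_exists => /forallP hit; exfalso.
have pr : H :\: S \proper H.
  rewrite properEneq subsetDl andbT; apply/eqP=> e.
  have [K [KH cK oK]] := omega_attained H.
  have := hit K; rewrite KH cK oK eqxx /= => /pred0Pn[x /andP[/= xK xS]].
  by have := subsetP KH x xK; rewrite -e inE xS.
have lt : omega (H :\: S) < omega H.
  have [K [KH cK oK]] := omega_attained (H :\: S).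
  have KH' := subset_trans KH (subsetDl _ _).
  rewrite ltn_neqAle omega_sub ?subsetDl // andbT; apply/eqP=> e.
  have := hit K; rewrite KH' cK oK e eqxx /=.
  by move: KH; rewrite subsetD => /andP[_ ->].
have := colourable_union (colourable_stable stS) (critical_proper pr).
rewrite setDE setUIr setUCr setIT (setUidPr SH) => /critical_colours.
by rewrite add1n ltnS -setDE leqNgt lt.
Qed.


(** The union of the two compatible colour classes [S1] and [S2] is a stable
set, and since every clique of [H] lies in [A] or in [B] it meets all the
maximum cliques.  Both star cutsets and disconnections are excluded in this
way. *)
Lemma critical_glue A B S1 S2 :
  A :|: B = H ->
  {in A :\: B & B :\: A, forall x y, ~~ adj x y} ->
  S1 \subset A -> stable S1 -> S2 \subset B -> stable S2 ->
  S1 :&: B \subset S2 -> S2 :&: A \subset S1 ->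
  (forall K, K \subset A -> clique K -> omega H <= #|K| -> ~~ [disjoint K & S1]) ->
  (forall K, K \subset B -> clique K -> omega H <= #|K| -> ~~ [disjoint K & S2]) ->
  False.
Proof.
move=> eH sep S1A /stableP st1 S2B /stableP st2 S12 S21 hit1 hit2.
have cross x y : x \in S1 -> y \in S2 -> ~~ adj x y.
  move=> x1 y2; have xA := subsetP S1A x x1; have yB := subsetP S2B y y2.
  case: (boolP (x \in B)) => xB.
    by apply: st2 => //; apply: (subsetP S12); rewrite inE x1.
  case: (boolP (y \in A)) => yA.
    by apply: st1 => //; apply: (subsetP S21); rewrite inE y2.
  by apply: sep; rewrite inE ?xA ?xB ?yA ?yB.
have SH : S1 :|: S2 \subset H by rewrite -eH setUSS.
have st : stable (S1 :|: S2).
  apply/stableP=> x y; rewrite !inE => /orP[xS|xS] /orP[yS|yS].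
  - exact: st1.
  - exact: cross.
  - by rewrite adj_sym cross.
  - exact: st2.
have [K [KH /cliqueP cK oK]] := critical_missed SH st.
rewrite -setI_eq0 setIUr setU_eq0 !setI_eq0 => /andP[d1 d2].
case: (boolP (K \subset A)) => [KA|/subsetPn[x xK xA]].
  by move: d1; apply/negP; apply: hit1; rewrite ?oK //; apply/cliqueP.
case: (boolP (K \subset B)) => [KB|/subsetPn[y yK yB]].
  by move: d2; apply/negP; apply: hit2; rewrite ?oK //; apply/cliqueP.
have := subsetP KH x xK; rewrite -eH inE (negbTE xA) /= => xB.
have := subsetP KH y yK; rewrite -eH inE (negbTE yB) orbF => yA.
have xy : y != x by apply: contraNneq yB => ->.
by have := sep y x; rewrite !inE xA yB xB yA cK // => /(_ isT isT).
Qed.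

Lemma critical_class A w : A \proper H -> w \in A ->
  exists S, [/\ S \subset A, stable S, w \in S &
    forall K, K \subset A -> clique K -> omega H <= #|K| -> ~~ [disjoint K & S]].
Proof.
move=> pA wA; apply: colour_class => //.
apply: colourable_leq (critical_proper pA).
exact: omega_sub (proper_sub pA).
Qed.

(** The colour classes of the centre [w] in the two parts agree on the overlap,
as both contain only [w] there. *)
Lemma critical_star_cutset A B w :
  A \proper H -> B \proper H -> A :|: B = H ->
  {in A :\: B & B :\: A, forall x y, ~~ adj x y} ->
  w \in A :&: B -> {in A :&: B, forall x, x != w -> adj w x} -> False.
Proof.
move=> pA pB eH sep; rewrite inE => /andP[wA wB] star.
have [S1 [S1A st1 w1 hit1]] := critical_class pA wA.
have [S2 [S2B st2 w2 hit2]] := critical_class pB wB.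
apply: critical_glue hit1 hit2 => //; apply/subsetP=> x; rewrite inE.
  move=> /andP[x1 xB]; have [->//|/star] := eqVneq x w.
  rewrite inE xB (subsetP S1A) // => /(_ isT).
  by rewrite (negbTE (stableP _ st1 _ _ w1 x1)).
move=> /andP[x2 xA]; have [->//|/star] := eqVneq x w.
rewrite inE xA (subsetP S2B) // => /(_ isT).
by rewrite (negbTE (stableP _ st2 _ _ w2 x2)).
Qed.

Lemma proper_missing X x : X \subset H -> x \in H -> x \notin X -> X \proper H.
Proof. by move=> XH xH xX; apply/properP; split=> //; exists x. Qed.

Lemma critical_connected X x y :
  X \subset H -> x \in X -> y \in H :\: X ->
  exists a b, [/\ a \in X, b \in H :\: X & adj a b].
Proof.
move=> XH xX yX.
case: (boolP [exists a in X, exists b in H :\: X, adj a b]).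
  by move=> /exists_inP[a aX /exists_inP[b bX ab]]; exists a, b.
move=> nex; exfalso.
have sep : {in X & H :\: X, forall a b, ~~ adj a b}.
  move=> a b aX bX; apply: contraNN nex => ab.
  by apply/exists_inP; exists a => //; apply/exists_inP; exists b.
move: (yX); rewrite inE => /andP[ynX yH].
have pX : X \proper H by apply: proper_missing yH ynX.
have pY : H :\: X \proper H.
  by apply: (@proper_missing _ x); rewrite ?subsetDl ?(subsetP XH) // inE xX.
have [S1 [S1X st1 _ hit1]] := critical_class pX xX.
have [S2 [S2Y st2 _ hit2]] := critical_class pY yX.
apply: critical_glue hit1 hit2 => //.
- by rewrite setDE setUIr setUCr setIT (setUidPr XH).
- move=> a b; rewrite !inE => /andP[_ aX] /andP[bX /andP[_ bH]].
  by apply: sep; rewrite ?inE ?bX.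
- by apply/subsetP=> a; rewrite !inE => /andP[/(subsetP S1X) ->].
- apply/subsetP=> a; rewrite !inE => /andP[/(subsetP S2Y)].
  by rewrite inE => /andP[/negbTE ->].
Qed.

(** A maximum clique of a join contains a maximum clique of each side, so a
colour class of an optimal colouring of one side meets all of them. *)
Lemma critical_not_join X x y :
  X \subset H -> x \in X -> y \in H :\: X ->
  exists a b, [/\ a \in X, b \in H :\: X & ~~ adj a b].
Proof.
move=> XH xX yX.
case: (boolP [exists a in X, exists b in H :\: X, ~~ adj a b]).
  by move=> /exists_inP[a aX /exists_inP[b bX ab]]; exists a, b.
move=> nex; exfalso.
have full : {in X & H :\: X, forall a b, adj a b}.
  move=> a b aX bX; apply: contraNT nex => ab.
  by apply/exists_inP; exists a => //; apply/exists_inP; exists b.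
move: (yX); rewrite inE => /andP[ynX yH].
have pX : X \proper H by apply: proper_missing yH ynX.
have [S [SX stS _ hit]] := colour_class (critical_proper pX) xX.
have [K [KH cK oK dK]] := critical_missed (subset_trans SX XH) stS.
have: ~~ [disjoint K :&: X & S].
  apply: hit; rewrite ?subsetIr ?(clique_sub (subsetIl _ _) cK) //.
  have [L [LX cL oL]] := omega_attained X.
  have: #|L :|: (K :\: X)| <= omega H.
    apply: clique_le_omega.
      by rewrite subUset (subset_trans LX XH) (subset_trans (subsetDl _ _) KH).
    apply/cliqueP=> a b; rewrite !inE.
    case/orP=> [aL|/andP[aX aK]]; case/orP=> [bL|/andP[bX bK]] ab.
    - exact: (cliqueP _ cL).
    - by apply: full; rewrite ?(subsetP LX) // inE bX (subsetP KH).
    - by rewrite adj_sym full ?(subsetP LX) // inE aX (subsetP KH).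
    - exact: (cliqueP _ cK).
  rewrite cardsU [L :&: _](_ : _ = set0) ?cards0 ?subn0; last first.
    apply/setP=> a; rewrite !inE; apply/negP=> /and3P[/(subsetP LX) aX].
    by rewrite aX.
  by rewrite -oK -oL -(cardsID X K) leq_add2r.
apply/negP; rewrite negbK; move: dK; apply: disjointWl.
by apply/subsetP=> a; rewrite inE => /andP[].
Qed.

Lemma critical_not_clique : ~~ clique H.
Proof.
apply/negP=> cH; have := critical_colours (colourable_card H).
by rewrite ltnNge clique_le_omega.
Qed.

(** This plays the part of the theorem of König for complements of bipartite
graphs.  Take non-adjacent [p] in [P] and [q] in [Q] and a maximum clique [K]
avoiding both, with [A] and [B] its parts in [P] and outside [P].  A clique in
[A :|: (Q :\: K)] remains a clique when [B] is added, so it has at most [#|A|]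
vertices; symmetrically for [B :|: (P :\: K)].  These two proper subsets cover
[H] and are coloured with [#|A| + #|B|] colours in total. *)
Lemma critical_not_cobipartite P Q : clique P -> clique Q -> P :|: Q = H -> False.
Proof.
move=> cP cQ eH; have [p [q [pH qH pq npq]]] := not_clique critical_not_clique.
wlog [pP qQ] : p q pH qH pq npq / p \in P /\ q \in Q.
  move=> wl; move: (pH) (qH); rewrite -eH !inE.
  case/orP=> [pP|pQ]; case/orP=> [qP|qQ].
  - by move: npq; rewrite (cliqueP _ cP).
  - by apply: (wl p q).
  - by apply: (wl q p); rewrite // 1?eq_sym // adj_sym.
  - by move: npq; rewrite (cliqueP _ cQ).
have npQ : p \notin Q by apply: contra npq => pQ; apply: (cliqueP _ cQ).
have nqP : q \notin P by apply: contra npq => qP; apply: (cliqueP _ cP).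
have pqH : [set p; q] \subset H by apply/subsetP=> x /set2P[]->.
have st : stable [set p; q].
  apply/stableP=> x y; rewrite !inE => /orP[] /eqP-> /orP[] /eqP->.
  - by rewrite adj_irr.
  - exact: npq.
  - by rewrite adj_sym.
  - by rewrite adj_irr.
have [K [KH cK oK]] := critical_missed pqH st.
rewrite disjoint_sym -setI_eq0 setIUl setU_eq0 !setI_eq0 !disjoints1 => /andP[pK qK].
pose A := K :&: P; pose B := K :\: P.
have card_K : #|A| + #|B| = omega H by rewrite cardsID.
have BQ x : x \in B -> x \in Q.
  by rewrite inE => /andP[xP /(subsetP KH)]; rewrite -eH inE (negbTE xP).
have bound (D C : {set G}) : D \subset K -> C \subset H -> clique C -> [disjoint C & D] ->
    {in C & D, forall x y, x != y -> adj x y} -> #|C| + #|D| <= omega H.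
  move=> DK CH cC dCD full.
  rewrite -cardsUI disjoint_setI0 // cards0 addn0; apply: clique_le_omega.
    by rewrite subUset CH (subset_trans DK).
  apply/cliqueP=> x y; rewrite !inE => /orP[xC|xD] /orP[yC|yD] xy.
  - exact: (cliqueP _ cC).
  - exact: full.
  - by rewrite adj_sym full // eq_sym.
  - by apply: (cliqueP _ cK) => //; apply: (subsetP DK).
have lX : omega (A :|: (Q :\: K)) <= #|A|.
  apply: omega_le => C /subsetP CX cC; rewrite -(leq_add2r #|B|) card_K.
  apply: bound => //.
  - exact: subsetDl.
  - apply/subsetP=> x /CX; rewrite -eH !inE.
    by case/orP=> [/andP[_ ->]|/andP[_ ->]] //; rewrite orbT.
  - rewrite disjoint_subset; apply/subsetP=> x /CX; rewrite !inE.
    by case/orP=> [/andP[-> ->]|/andP[/negbTE ->]]; rewrite ?andbF.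
  - move=> x y /CX; rewrite !inE => xX yB xy.
    case/orP: xX => [/andP[xK _]|/andP[_ xQ]].
      by apply: (cliqueP _ cK); case/andP: yB.
    by apply: (cliqueP _ cQ) => //; apply: BQ; rewrite inE.
have lY : omega (B :|: (P :\: K)) <= #|B|.
  apply: omega_le => C /subsetP CX cC; rewrite -(leq_add2r #|A|) [X in _ <= X]addnC card_K.
  apply: bound => //.
  - exact: subsetIl.
  - apply/subsetP=> x /CX; rewrite -eH inE => /orP[/BQ xQ|].
      by rewrite inE xQ orbT.
    by rewrite !inE => /andP[_ ->].
  - rewrite disjoint_subset; apply/subsetP=> x /CX; rewrite !inE.
    by case/orP=> [/andP[/negbTE -> ->]|/andP[/negbTE ->]].
  - move=> x y /CX; rewrite !inE => xX /andP[yK yP] xy.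
    case/orP: xX => [/andP[_ xK]|/andP[_ xP]].
      exact: (cliqueP _ cK).
    exact: (cliqueP _ cP).
suff: omega H < omega (A :|: (Q :\: K)) + omega (B :|: (P :\: K)).
  by rewrite -card_K ltnNge leq_add.
have eU : (A :|: (Q :\: K)) :|: (B :|: (P :\: K)) = H.
  apply/setP=> x; rewrite -eH !inE.
  case: (boolP (x \in K)) => [/(subsetP KH)|_]; last by rewrite /= !andbF /= orbC.
  by rewrite -eH !inE; case: (x \in P); case: (x \in Q).
have := subxx H; rewrite -{1}eU subUset => /andP[sX sY].
apply: critical_cover eU.
  by apply: proper_missing sX pH _; rewrite !inE (negbTE pK) (negbTE npQ).
by apply: proper_missing sY qH _; rewrite !inE (negbTE qK) (negbTE nqP).
Qed.

End Critical.
End Colouring.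

(** * Forks and crowns as configurations of vertices *)

Section Fork.
Variable G : sgraph.
Implicit Types (a b c d e p t u v w x y z : G) (H X Y : {set G}).

(** [c] is the centre, [a], [b] and [d] its neighbours, and [e] is pendant at
[a]; all the vertices but [b] and [d] are told apart by their adjacencies. *)
Definition forkless := forall c a b d e : G,
  adj c a -> adj c b -> adj c d -> adj a e -> b != d ->
  ~~ adj a b -> ~~ adj a d -> ~~ adj b d ->
  ~~ adj c e -> ~~ adj b e -> ~~ adj d e -> False.

(** [c] is the centre of the claw with leaves [a], [b], [d], and [u] the vertex
joined to it. *)
Definition crownless := forall u c a b d : G,
  adj u c -> adj u a -> adj u b -> adj u d -> adj c a -> adj c b -> adj c d ->
  a != b -> a != d -> b != d ->
  ~~ adj a b -> ~~ adj a d -> ~~ adj b d -> False.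

Lemma not_free_embedding (F : sgraph) (g : F -> G) :
  injective g -> (forall i j, adj (g i) (g j) = adj i j) -> ~ free F G.
Proof.
move=> gI gA; apply; exists (g @: setT).
have gX i : g i \in g @: setT by apply: imset_f; rewrite inE.
pose h i : induced (g @: setT) := Sub (g i) (gX i).
have hI : injective h by move=> i j /(congr1 val) /gI.
have hS (s : induced (g @: setT)) : exists i, s == h i.
  by have /imsetP[i _ e] := valP s; exists i; apply/eqP/val_inj.
pose f s := xchoose (hS s).
have fK : cancel f h by move=> s; rewrite -(eqP (xchooseP (hS s))).
exists f; first by exists h => // i; apply: hI; rewrite fK.
by move=> s1 s2; rewrite -gA -{2}[s1]fK -{2}[s2]fK.
Qed.

Lemma adj_neq x y : adj x y -> x != y.
Proof. by apply: contraTneq => ->; rewrite adj_irr. Qed.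

Lemma free_crown : free crown G -> crownless.
Proof.
move=> fr u c a b d uc ua ub ud ca cb cd ab ad bd nab nad nbd.
pose g (i : crown) : G := match i with
  | inl _ => u | inr (inl _) => c
  | inr (inr k) => nth a [:: a; b; d] k end.
suff [gI gA] : injective g /\ forall i j, adj (g i) (g j) = adj i j.
  exact: not_free_embedding gI gA fr.
split=> i j; rewrite /g.
  case: i => [[[|] //= i]|[[[|] //= i]|[[|[|[|]]] //= i]]];
  case: j => [[[|] //= j]|[[[|] //= j]|[[|[|[|]]] //= j]]]; first
    [ by move=> _; apply/eqP
    | move/eqP=> h; exfalso; move: h; apply/negP; first
      [ by [] | by rewrite eq_sym | exact: adj_neq
      | by rewrite eq_sym; apply: adj_neq ] ].
case: i => [[[|] //= i]|[[[|] //= i]|[[|[|[|]]] //= i]]];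
case: j => [[[|] //= j]|[[[|] //= j]|[[|[|[|]]] //= j]]];
rewrite ?adj_irr //; first [by [] | by rewrite adj_sym | apply/negbTE].
all: by [] || by rewrite adj_sym.
Qed.

Lemma free_fork : free fork G -> forkless.
Proof.
move=> fr c a b d e ca cb cd ae bd nab nad nbd nce nbe nde.
have ab : a != b by apply: contraNneq nbe => <-.
have ad : a != d by apply: contraNneq nde => <-.
have eb : e != b by apply: contraNneq nab => <-.
have ed : e != d by apply: contraNneq nad => <-.
have ec : e != c by apply: contraNneq nbe => ->; rewrite adj_sym.
(* Subdividing the edge from the centre to leaf 0 puts [None] at distance one
   from the centre and leaf 0 at distance two. *)
pose g (i : fork) : G := match i with
  | None => a | Some (inl _) => c
  | Some (inr k) => nth a [:: e; b; d] k end.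
suff [gI gA] : injective g /\ forall i j, adj (g i) (g j) = adj i j.
  exact: not_free_embedding gI gA fr.
split=> i j; rewrite /g.
  case: i => [[[[|] //= i]|[[|[|[|]]] //= i]]|];
  case: j => [[[[|] //= j]|[[|[|[|]]] //= j]]|]; first
    [ by move=> _; apply/eqP
    | move/eqP=> h; exfalso; move: h; apply/negP; first
      [ by [] | by rewrite eq_sym | exact: adj_neq
      | by rewrite eq_sym; apply: adj_neq ] ].
case: i => [[[[|] //= i]|[[|[|[|]]] //= i]]|];
case: j => [[[[|] //= j]|[[|[|[|]]] //= j]]|];
rewrite /= /subdivide_adj /= ?eqEsubset ?subUset ?sub1set ?inE /= ?adj_irr //.
all: first [ by [] | by rewrite adj_sym | exact: negbTE
           | by apply: negbTE; rewrite adj_sym ].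
Qed.

Hypothesis fork_free : forkless.

(** * Neighbourhoods in critical sets of a fork-free graph *)

(** If [y] in [H] is not adjacent to [t], then its neighbours and
non-neighbours within [T] are complete to each other, as otherwise [t], [p] and
[y] would belong to a fork.  Hence every component [X] of the complement of the
graph induced on [T] is homogeneous in [H]: a vertex outside [X] is adjacent to
all of [X] or to none.  If [X] has a second vertex besides [x], then [x] and the
common neighbours of [X] form a star cutset separating the rest of [X] from the
vertices with no neighbour in [X], and the latter exist since [H] is not a
join. *)
Lemma attachment H p t : critical H -> p \notin H -> {in H, forall x, ~~ adj p x} ->
  adj p t -> {in H, forall x, adj t x} \/ clique [set x in H | adj t x].
Proof.
move=> cH pnH pH pt; set T := [set x in H | adj t x].
have [cT|/not_clique[x [x' [xT x'T xx' nxx']]]] := boolP (clique T); first by right.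
left=> y0 y0H; apply: contraT => nty0.
have TP z : z \in T -> z \in H /\ adj t z by rewrite inE => /andP.
have outside y z z' : y \in H -> ~~ adj t y -> z \in T -> z' \in T ->
    ~~ adj z z' -> adj y z -> adj y z'.
  move=> yH nty /TP[zH tz] /TP[z'H tz'] nzz' yz; apply: contraT => nyz'.
  have zz' : z != z' by apply: contraNneq nyz' => <-.
  have pz' : p != z'.
    by apply: contraNneq pnH => ->.
  case: (@fork_free t z p z' y) => //.
  - by rewrite adj_sym.
  - by rewrite adj_sym.
  - by rewrite adj_sym pH.
  - exact: pH.
  - exact: pH.
  - by rewrite adj_sym.
(* [co] also relates each vertex of [T] to itself, which does not change the
   components. *)
pose co : rel G := fun z z' => [&& z \in T, z' \in T & ~~ adj z z'].
pose X := [set z | connect co x z].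
have inX z : (z \in X) = connect co x z by rewrite inE.
clearbody X.
have co_sym : connect_sym co.
  by apply: sym_connect_sym => z z'; rewrite /co andbCA adj_sym.
have XT z : z \in X -> z \in T.
  rewrite inX => /(closed_connect (a := mem T)) <- // w w'.
  by rewrite /co => /and3P[-> ->].
have xX : x \in X by rewrite inX connect0.
have x'X : x' \in X by rewrite inX; apply: connect1; rewrite /co xT x'T.
have XH : X \subset H by apply/subsetP=> z /XT /TP[].
have homogeneous y z : y \in H :\: X -> z \in X -> adj y z = adj y x.
  rewrite inE => /andP[ynX yH]; rewrite inX => xz.
  have [yT|ynT] := boolP (y \in T).
    have full w : w \in X -> adj y w.
      move=> wX; apply: contraNT ynX => nyw; rewrite inX.
      apply: connect_trans (_ : connect co x w) _; first by rewrite -inX.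
      by apply: connect1; rewrite /co XT // yT adj_sym.
    by rewrite !full // inX.
  have nty : ~~ adj t y by move: ynT; rewrite inE yH.
  suff cl : closed co [pred w | adj y w].
    by have := closed_connect cl xz; rewrite !inE.
  move=> w w' /and3P[wT w'T nww']; rewrite !inE.
  by apply/idP/idP; apply: outside => //; rewrite adj_sym.
have y0X : y0 \in H :\: X.
  by rewrite inE y0H andbT; apply: contra nty0 => /XT /TP[].
have [z1 [z [z1X zX]]] := critical_not_join cH XH xX y0X.
rewrite adj_sym (homogeneous z z1) // => nzx.
move: (zX); rewrite inE => /andP[znX zH].
exfalso.
pose N := [set w in H :\: X | adj w x].
apply: (@critical_star_cutset _ H cH (X :|: N) (x |: (H :\: X)) x).
- apply: (@proper_missing _ _ _ z); rewrite ?inE ?zH ?(negbTE znX) ?(negbTE nzx) //.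
  by rewrite subUset XH; apply/subsetP=> w; rewrite !inE => /andP[/andP[]].
- apply: (@proper_missing _ _ _ x'); rewrite ?(subsetP XH) //.
    by rewrite subUset sub1set (subsetP XH) // subsetDl.
  by rewrite !inE eq_sym (negbTE xx') x'X.
- apply/setP=> w; rewrite !inE.
  have [->|_] := eqVneq w x; first by rewrite xX (subsetP XH).
  have [/(subsetP XH) ->//|_] := boolP (w \in X).
  by case: (w \in H); rewrite ?orbT.
- move=> w w'; rewrite !inE => /andP[h1 h2] /andP[h3 h4].
  have wX : w \in X.
    by move: h1 h2; case: (w \in X); rewrite //= negb_or => /andP[_ /negbTE->].
  have w'X : w' \in H :\: X.
    rewrite inE; case/orP: h4 => // /eqP ew.
    by move: h3; rewrite ew xX.
  rewrite adj_sym homogeneous //; move: h3 w'X; rewrite inE.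
  by case: (w' \in X) => //= h3 w'H; move: h3; rewrite w'H.
- by rewrite !inE xX eqxx.
- move=> w; rewrite !inE adj_sym => /andP[wA wB] wx; move: wA wB.
  by rewrite (negbTE wx) /=; case: (w \in X); rewrite ?andbF //= => /andP[].
Qed.

(** * The claw and the distance from its centre *)

Definition claw_at v a b c : bool :=
  [&& adj v a, adj v b, adj v c, a != b, a != c, b != c,
      ~~ adj a b, ~~ adj a c & ~~ adj b c].

Lemma claw_at_rot v a b c : claw_at v a b c -> claw_at v b c a.
Proof.
by rewrite /claw_at (eq_sym c) (adj_sym c) (eq_sym b a) (adj_sym b a)
  => /and5P[-> -> -> -> /and5P[-> -> -> -> ->]].
Qed.

(** A neighbour of exactly one leaf would extend the claw to a fork.  The cyclic
shape of the conclusion matches [claw_at_pair]. *)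
Lemma claw_at_two v a b c x : claw_at v a b c -> ~~ adj v x ->
  [|| adj a x, adj b x | adj c x] ->
  [|| adj a x && adj b x, adj b x && adj c x | adj c x && adj a x].
Proof.
have one a' b' c' : claw_at v a' b' c' -> ~~ adj v x -> adj a' x ->
    adj b' x || adj c' x.
  move=> /and5P[va vb vc ab /and5P[ac bc nab nac nbc]] nvx ax.
  apply: contraT; rewrite negb_or => /andP[nbx ncx].
  by case: (@fork_free v a' b' c' x).
move=> cl nvx; have cl1 := claw_at_rot cl; have cl2 := claw_at_rot cl1.
case/or3P=> ax; [move: (one _ _ _ cl nvx ax) | move: (one _ _ _ cl1 nvx ax)
  | move: (one _ _ _ cl2 nvx ax)]; rewrite ax.
all: by case/orP=> ->; rewrite ?orbT.
Qed.

Definition claw_pair v p q : bool :=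
  [&& adj v p, adj v q, p != q & ~~ adj p q].

(** Reduces case distinctions over two of the three leaves to one pair. *)
Lemma claw_at_pair v a b c (P : pred G) : claw_at v a b c ->
  [|| P a && P b, P b && P c | P c && P a] ->
  exists p q, [/\ claw_pair v p q, P p, P q,
                  p \in [set a; b; c] & q \in [set a; b; c]].
Proof.
rewrite /claw_at => /and5P[va vb vc ab /and5P[ac bc nab nac nbc]].
case/or3P=> /andP[P1 P2]; [exists a, b | exists b, c | exists c, a].
all: by rewrite /claw_pair ?va ?vb ?vc ?ab ?bc 1?eq_sym ?ac ?nab ?nbc
  1?adj_sym ?nac P1 P2 !inE !eqxx ?orbT.
Qed.

(** In a connected graph, distance at least three from [v]. *)
Definition far v x : bool :=
  [&& x != v, ~~ adj v x & [forall u, adj v u ==> ~~ adj u x]].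

Lemma farP v x u : far v x -> adj v u -> ~~ adj u x.
Proof. by move=> /and3P[_ _ /forallP/(_ u)/implyP]. Qed.

Lemma notfar_neighbour v x z : far v z -> ~~ far v x -> adj x z ->
  exists2 u, adj v u & adj u x.
Proof.
move=> fz nfx xz; have nvx : ~~ adj v x by apply: contraTN xz; apply: farP.
move: nfx; rewrite /far nvx /=; have [ex|_ /=] := eqVneq x v.
  by move: fz; rewrite /far -ex xz andbF.
rewrite negb_forall => /existsP[u]; rewrite negb_imply negbK => /andP[vu ux].
by exists u.
Qed.

(** Here [w] is at distance two from [v] and [z] at distance three.  If [w] saw
no leaf, a common neighbour [u] of [v] and [w] would be adjacent to two leaves,
since otherwise two leaves, [v], [u] and [w] form a fork; but then [u] with those
leaves and the path to [w] and [z] is a fork. *)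
Lemma second_level v a b c w z : claw_at v a b c ->
  far v z -> ~~ far v w -> adj w z ->
  exists p q, [/\ claw_pair v p q, adj w p & adj w q].
Proof.
move=> cl fz nfw wz; have [u vu uw] := notfar_neighbour fz nfw wz.
have nvw : ~~ adj v w by apply: contraTN wz; apply: farP.
have [aw|] := boolP [|| adj a w, adj b w | adj c w].
  have [p [q [pq pw qw _ _]]] :=
    claw_at_pair (P := fun p => adj p w) cl (claw_at_two cl nvw aw).
  by exists p, q; rewrite !(adj_sym w).
rewrite !negb_or => /and3P[naw nbw ncw]; exfalso.
have pick2 : [|| adj u a && adj u b, adj u b && adj u c | adj u c && adj u a].
  have one p q : adj v p -> adj v q -> p != q -> ~~ adj p q ->
      ~~ adj p w -> ~~ adj q w -> adj u p || adj u q.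
    move=> vp vq pq npq npw nqw; apply: contraT; rewrite negb_or => /andP[up uq].
    by case: (@fork_free v u p q w).
  move: (cl) => /and5P[va vb vc ab /and5P[ac bc nab nac nbc]].
  move: (one a b va vb ab nab naw nbw) (one a c va vc ac nac naw ncw).
  move: (one b c vb vc bc nbc nbw ncw).
  by case: (adj u a); case: (adj u b); case: (adj u c).
have [p [q [/and4P[vp vq pq npq] up uq pS qS]]] := claw_at_pair cl pick2.
have nw r : r \in [set a; b; c] -> ~~ adj r w.
  by rewrite !inE -orbA => /or3P[]/eqP->.
have nz r : adj v r -> ~~ adj r z by apply: farP.
by case: (@fork_free u w p q z); rewrite ?nz // adj_sym nw.
Qed.

(** Otherwise [w], two of its neighbours from [second_level], and the path from
[w] through [z] to [y] form a fork. *)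
Lemma far_step v a b c w z y : claw_at v a b c ->
  far v z -> ~~ far v w -> adj w z -> far v y -> adj z y -> adj w y.
Proof.
move=> cl fz nfw wz fy zy; apply: contraT => nwy.
have [p [q [/and4P[vp vq pq npq] wp wq]]] := second_level cl fz nfw wz.
have nz r : adj v r -> ~~ adj z r by move=> vr; rewrite adj_sym (farP fz).
have ny r : adj v r -> ~~ adj r y by apply: farP.
by case: (@fork_free w z p q y); rewrite // ?nz // ny.
Qed.

(** There is no vertex at distance four from [v]: by [far_step] the vertices at
distance at most three are closed under adjacency. *)
Lemma far_near_neighbour v a b c y : connected G -> claw_at v a b c ->
  far v y -> exists2 w, ~~ far v w & adj w y.
Proof.
move=> conn cl fy; pose D := [pred x | far v x ==> [exists w, ~~ far v w && adj w x]].
suff cD : closed (@adj G) D.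
  have := closed_connect cD (conn v y).
  rewrite !inE /far eqxx /= -/(far v y) fy => /esym/existsP[w /andP[nw wy]].
  by exists w.
have step x z : adj x z -> x \in D -> z \in D.
  rewrite !inE => xz xD; apply/implyP=> fz; apply/existsP.
  have [fx|nfx] := boolP (far v x); last by exists x; rewrite nfx.
  move: xD; rewrite fx => /existsP[w /andP[nfw wx]].
  by exists w; rewrite nfw (far_step cl fx).
by move=> x z xz; apply/idP/idP; apply: step; rewrite // adj_sym.
Qed.

Lemma critical_edge H : critical H -> exists x y, [/\ x \in H, y \in H & adj x y].
Proof.
move=> cH; have [x [y [xH yH xy _]]] := not_clique (critical_not_clique cH).
have sub : [set x] \subset H by rewrite sub1set.
have yx : y \in H :\: [set x] by rewrite !inE eq_sym xy.
have [_ [b [/set1P-> bH xb]]] := critical_connected cH sub (set11 x) yx.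
by exists x, b; split=> //; move: bH; rewrite inE => /andP[].
Qed.

(** If all of [H] were far from [v], then by [far_step] a vertex [w] at distance
two with one neighbour in the connected set [H] would be complete to [H], and
the path from [w] towards [v] together with two non-adjacent vertices of [H]
would be a fork. *)
Lemma critical_not_far v a b c H : connected G -> claw_at v a b c ->
  critical H -> exists2 x, x \in H & ~~ far v x.
Proof.
move=> conn cl cH.
have [/forall_inP fH|] := boolP [forall x in H, far v x]; last first.
  rewrite negb_forall => /existsP[x]; rewrite negb_imply => /andP[xH nfx].
  by exists x.
have [x0 [_ [x0H _ _]]] := critical_edge cH.
have [w nfw wx0] := far_near_neighbour conn cl (fH _ x0H).
have full : {in H, forall x, adj w x}.
  move=> y yH; apply: contraT => nwy; pose X := [set x in H | adj w x].
  have XH : X \subset H by apply/subsetP=> x; rewrite inE => /andP[].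
  have x0X : x0 \in X by rewrite inE x0H.
  have yX : y \in H :\: X by rewrite !inE yH (negbTE nwy).
  have [x [z [xX zX xz]]] := critical_connected cH XH x0X yX.
  move: xX zX; rewrite !inE => /andP[xH wx] /andP[+ zH].
  by rewrite zH (far_step cl (fH x xH) nfw wx (fH z zH) xz).
have [p [q [/and4P[vp _ _ _] wp _]]] := second_level cl (fH _ x0H) nfw wx0.
have [x [y [xH yH xy nxy]]] := not_clique (critical_not_clique cH).
have nv z : z \in H -> ~~ adj z v by rewrite adj_sym => /fH/and3P[].
have nvw : ~~ adj w v.
  by rewrite adj_sym; apply: contraTN wx0; apply: farP; apply: fH.
have np z : z \in H -> ~~ adj p z by move=> zH; apply: farP (fH z zH) vp.
by case: (@fork_free w p x y v); rewrite // ?full ?np ?nv // adj_sym.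
Qed.

(** * Critical sets of non-neighbours of the centre *)

Section Near.
Variables (v a b c : G) (H : {set G}).
Hypothesis crown_free : crownless.
Hypothesis claw_v : claw_at v a b c.
Hypothesis critH : critical H.
Hypothesis HM : H \subset nonneighbors v.

Lemma nonadjacent_centre x : x \in H -> ~~ adj v x.
Proof. by move=> /(subsetP HM); rewrite !inE negb_or => /andP[]. Qed.

Lemma centre_notin : v \notin H.
Proof. by apply/negP=> /(subsetP HM); rewrite !inE eqxx orbT. Qed.

(** Two non-adjacent vertices of [H] outside the neighbourhood of [s] would form
a fork with [t], [v] and [s], so the non-neighbours of [s] in [H] form a clique;
its neighbours cannot form another one, hence are all of [H] by
[attachment]. *)
Lemma complete_spread t s : adj v t -> {in H, forall x, adj t x} ->
  adj v s -> t != s -> ~~ adj t s -> {in H, forall x, adj s x}.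
Proof.
move=> vt tH vs ts nts.
have [//|cT] := attachment critH centre_notin nonadjacent_centre vs.
exfalso; apply: (critical_not_cobipartite critH cT (Q := H :\: [set x in H | adj s x])).
  apply: contraT => /not_clique[x [y []]]; rewrite !inE.
  move=> /andP[nx xH] /andP[ny yH] xy nxy; move: nx ny; rewrite xH yH /= => nx ny.
  have nv z : z \in H -> ~~ adj v z := @nonadjacent_centre z.
  have tv : adj t v by rewrite adj_sym.
  by case: (@fork_free t v x y s); rewrite // ?tH // ?nv // adj_sym.
by apply/setP=> x; rewrite !inE; case: (x \in H); case: (adj s x).
Qed.

(** All three leaves would be complete to [H], and an edge of [H] would complete
them to a crown. *)
Lemma leaf_not_complete a' b' c' : claw_at v a' b' c' ->
  ~ {in H, forall x, adj a' x}.
Proof.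
move=> /and5P[va vb vc ab /and5P[ac bc nab nac nbc]] aH.
have bH := complete_spread va aH vb ab nab.
have cH := complete_spread va aH vc ac nac.
have [x [y [xH yH xy]]] := critical_edge critH.
by apply: (@crown_free x y a' b' c') => //; rewrite adj_sym ?aH ?bH ?cH.
Qed.

(** By [complete_spread] such a vertex is adjacent to all the leaves of the claw,
and forms a crown with it. *)
Lemma neighbour_not_complete t : adj v t -> ~ {in H, forall x, adj t x}.
Proof.
move=> vt tH.
have all_adj a' b' c' : claw_at v a' b' c' -> adj t a'.
  move=> cl; apply: contraT => nta; case: (leaf_not_complete cl).
  have [<-//|ta] := eqVneq t a'.
  by apply: complete_spread tH _ ta nta; case/and5P: cl.
have cl1 := claw_at_rot claw_v; have cl2 := claw_at_rot cl1.
have ta := all_adj _ _ _ claw_v; have tb := all_adj _ _ _ cl1.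
have tc := all_adj _ _ _ cl2.
case/and5P: claw_v => va vb vc ab /and5P[ac bc nab nac nbc].
exact: (@crown_free v t a b c).
Qed.

Lemma neighbour_clique t : adj v t -> clique [set x in H | adj t x].
Proof.
move=> vt; have [tH|//] := attachment critH centre_notin nonadjacent_centre vt.
by case: (neighbour_not_complete vt tH).
Qed.

Let S := [set x in H | [|| adj a x, adj b x | adj c x]].

Lemma shadow_pair x : x \in S -> exists p q,
  [/\ claw_pair v p q, adj p x, adj q x, p \in [set a; b; c] & q \in [set a; b; c]].
Proof.
rewrite inE => /andP[xH ax]; have nvx := nonadjacent_centre xH.
have two := claw_at_two claw_v nvx ax.
exact: (claw_at_pair (P := fun p => adj p x) claw_v two).
Qed.

Lemma outside_shadow x p : x \in H -> x \notin S -> p \in [set a; b; c] ->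
  ~~ adj p x.
Proof.
move=> xH; rewrite inE xH /= !negb_or => /and3P[nax nbx ncx].
by rewrite !inE -orbA => /or3P[]/eqP->.
Qed.

(** Two vertices of [S] are each adjacent to at least two of the three leaves, so
they have a common one, whose neighbours in [H] form a clique. *)
Lemma shadow_clique : clique S.
Proof.
case/and5P: claw_v => va vb vc _ _.
apply/cliqueP=> x y; rewrite !inE => /andP[xH ax] /andP[yH ay] xy.
have two z (zH : z \in H) :=
  claw_at_two (x := z) claw_v (nonadjacent_centre zH).
have common p : adj v p -> adj p x -> adj p y -> adj x y.
  by move=> vp px py; apply: (cliqueP _ (neighbour_clique vp)); rewrite ?inE ?xH ?yH.
case/or3P: (two x xH ax) (two y yH ay) => /andP[p1 p2] /or3P[] /andP[q1 q2].
all: first [exact: (common a) | exact: (common b) | exact: (common c)].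
Qed.

(** If no leaf had a neighbour in [H], then [t] would be adjacent to two leaves,
and an edge leaving the clique of neighbours of [t] in [H] would give a fork.
Otherwise [S] is a nonempty clique.  A vertex [x] of [S] with a neighbour outside
[S] is complete to [H :\: S]: its neighbours there are closed under adjacency,
as seen from a fork at [x] with two leaves of the claw, and a clique is not a
cutset.  Finally two non-adjacent vertices outside [S] would form a fork with
[x], a leaf and [v]. *)
Lemma near_contradiction t x0 : adj v t -> x0 \in H -> adj t x0 -> False.
Proof.
move=> vt x0H tx0.
have SH : S \subset H by apply/subsetP=> x; rewrite inE => /andP[].
have [x1 x1S|S0] := pickP (mem S); last first.
  have nleaf x p : x \in H -> p \in [set a; b; c] -> ~~ adj p x.
    by move=> xH; apply: outside_shadow => //; apply/negbT/S0.
  have pick2 : [|| adj t a && adj t b, adj t b && adj t c | adj t c && adj t a].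
    have one p q : adj v p -> adj v q -> p != q -> ~~ adj p q ->
        p \in [set a; b; c] -> q \in [set a; b; c] -> adj t p || adj t q.
      move=> vp vq pq npq pS qS; apply: contraT; rewrite negb_or => /andP[tp tq].
      by case: (@fork_free v t p q x0); rewrite // ?nonadjacent_centre // nleaf.
    move: (claw_v) => /and5P[va vb vc ab /and5P[ac bc nab nac nbc]].
    move: (one a b va vb ab nab) (one a c va vc ac nac) (one b c vb vc bc nbc).
    rewrite !inE !eqxx !orbT => /(_ isT isT) + /(_ isT isT) + /(_ isT isT).
    by case: (adj t a); case: (adj t b); case: (adj t c).
  have [p [q [/and4P[vp vq pq npq] tp tq pS qS]]] := claw_at_pair claw_v pick2.
  pose T := [set x in H | adj t x].
  have TH : T \subset H by apply/subsetP=> x; rewrite inE => /andP[].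
  have x0T : x0 \in T by rewrite inE x0H.
  have [HT|/subsetPn[y0 y0H y0T]] := boolP (H \subset T).
    by case: (neighbour_not_complete vt) => x /(subsetP HT); rewrite inE => /andP[].
  have y0X : y0 \in H :\: T by rewrite inE y0T.
  have [x [y [xT yT xy]]] := critical_connected critH TH x0T y0X.
  move: xT yT; rewrite !inE => /andP[xH tx] /andP[+ yH]; rewrite yH /= => nty.
  by case: (@fork_free t x p q y); rewrite // 1?(adj_sym x) nleaf.
have [y0 y0R|R0] := pickP (mem (H :\: S)); last first.
  apply: (critical_not_cobipartite critH shadow_clique shadow_clique).
  rewrite setUid; apply/eqP; rewrite eqEsubset SH; apply/subsetP=> x xH.
  by apply: contraFT (R0 x) => xS; rewrite /= inE xS.
have [x [y [xS yR xy]]] := critical_connected critH SH x1S y0R.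
have [p [q [/and4P[vp vq pq npq] px qx pS qS]]] := shadow_pair xS.
have xH := subsetP SH x xS.
have nleaf z r : z \in H :\: S -> r \in [set a; b; c] -> ~~ adj r z.
  by rewrite inE => /andP[zS zH]; apply: outside_shadow.
have step z z' : z \in H :\: S -> z' \in H :\: S -> adj x z -> adj z z' -> adj x z'.
  move=> zR z'R xz zz'; apply: contraT => nxz'.
  by case: (@fork_free x z p q z'); rewrite // 1?(adj_sym x) // 1?(adj_sym z) nleaf.
have full : {in H :\: S, forall z, adj x z}.
  move=> z0 z0R; apply: contraT => nxz0; exfalso.
  pose Y := [set z in H :\: S | adj x z].
  have zH z : z \in H :\: S -> z \in H by rewrite inE => /andP[].
  apply: (@critical_star_cutset _ H critH (S :|: Y) (H :\: Y) x).
  - apply: (@proper_missing _ _ _ z0); rewrite ?zH //.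
      by rewrite subUset SH; apply/subsetP=> z; rewrite inE => /andP[/zH].
    by move: z0R; rewrite in_setU [z0 \in Y]inE (negbTE nxz0) andbF orbF inE => /andP[].
  - apply: (@proper_missing _ _ _ y); rewrite ?subsetDl ?zH //.
    by rewrite inE [y \in Y]inE yR xy.
  - apply/setP=> z; rewrite in_setU in_setU in_setD.
    have [zY|_] := boolP (z \in Y).
      by rewrite orbT /=; move: zY; rewrite inE => /andP[/zH ->].
    by have [/(subsetP SH) ->|] := boolP (z \in S).
  - move=> z z'; rewrite !in_setD !in_setU negb_and negbK negb_or.
    move=> /andP[h1 h2] /and3P[/andP[z'S z'Y] _ z'H].
    have zY : z \in Y.
      case/orP: h1 => // nzH; case/orP: h2 => // /(subsetP SH).
      by rewrite (negbTE nzH).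
    move: zY; rewrite inE => /andP[zR xz].
    have z'R : z' \in H :\: S by rewrite inE z'S.
    apply: contraNN z'Y => zz'; rewrite inE z'R /=; exact: step xz zz'.
  - by rewrite !in_setI in_setU in_setD xS xH [x \in Y]inE adj_irr andbF.
  - move=> z; rewrite in_setI in_setU in_setD => /andP[/orP[zS _ zx|-> //]].
    by apply: (cliqueP _ shadow_clique); rewrite 1?eq_sym.
apply: (critical_not_cobipartite critH shadow_clique (Q := H :\: S)); last first.
  by rewrite setDE setUIr setUCr setIT (setUidPr SH).
apply: contraT => /not_clique[z [z' [zR z'R zz' nzz']]].
have xp : adj x p by rewrite adj_sym.
have nv w : w \in H -> ~~ adj w v by move/nonadjacent_centre; rewrite adj_sym.
have [zH z'H] : z \in H /\ z' \in H.
  by move: zR z'R; rewrite !inE => /andP[_ ->] /andP[_ ->].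
by case: (@fork_free x p z z' v);
  rewrite // ?(nv x) ?(nv z) ?(nv z') // ?full // ?nleaf // adj_sym.
Qed.

End Near.
End Fork.

(** * From vertex sets back to induced subgraphs *)

Lemma chromatic_clique_tight (F G : sgraph) (g : F -> G) : injective g ->
  (forall x y, adj (g x) (g y) = adj x y) -> tight (g @: setT) ->
  chromatic_number F = clique_number F.
Proof.
move=> gI gA tg.
have cl (K : {set F}) : clique (g @: K) = clique K.
  apply/cliqueP/cliqueP => [cK x y xK yK xy|cK _ _ /imsetP[x xK ->] /imsetP[y yK ->]].
    by rewrite -gA; apply: cK; rewrite ?imset_f ?(inj_eq gI).
  by rewrite gA (inj_eq gI); apply: cK.
rewrite /chromatic_number; case: ex_minnP => k /existsP[c /forallP cP] kmin.
apply/eqP; rewrite eqn_leq; apply/andP; split; last first.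
  apply/bigmax_leqP=> K /cliqueP cK; rewrite -[k]card_ord.
  have cI : {in K &, injective c}.
    move=> x y xK yK exy; apply: contraTeq isT => xy.
    move: (cP x) => /forallP/(_ y)/implyP.
    by rewrite cK // => /(_ isT); rewrite exy eqxx.
  by rewrite -(card_in_imset cI) max_card.
apply: leq_trans (_ : omega (g @: setT) <= _); last first.
  apply: omega_le => L LX cL.
  have eL : L = g @: (g @^-1: L).
    apply/setP=> y; apply/idP/imsetP => [yL|[x + ->]]; last by rewrite inE.
    by have /imsetP[x _ ey] := subsetP LX y yL; exists x; rewrite // inE -ey.
  rewrite eL card_imset //.
  apply: (@leq_bigmax_cond _ (fun K => clique K) (fun K : {set F} => #|K|)).
  by rewrite -cl -eL.
apply: kmin; case/colourable_setP: tg => d dk dP.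
have gX x : g x \in g @: setT by rewrite imset_f.
apply/existsP; exists [ffun x => Ordinal (dk _ (gX x))].
apply/forallP=> x; apply/forallP=> y; apply/implyP=> xy.
by rewrite !ffunE; apply: dP; rewrite ?gA.
Qed.

Lemma claw_centre (G : sgraph) (Q : {set G}) (v : induced Q) :
  isomorphic (induced Q) claw -> degree v = 3 ->
  exists a b c, claw_at (val v) a b c.
Proof.
move=> [f [g fK gK] fA] dv.
have gA i j : adj (val (g i)) (val (g j)) = adj i j.
  by rewrite -[LHS]/(adj (g i) (g j)) -fA !gK.
case fv : (f v) => [i|i]; last first.
  (* A leaf of the claw has only the centre as neighbour. *)
  suff: degree v <= 1 by rewrite dv.
  rewrite -(cards1 (g (inl ord0))); apply/subset_leq_card/subsetP=> w.
  rewrite !inE -fA fv; case fw: (f w) => [j|j] // _.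
  by rewrite -[w]fK fw (ord1 j).
have nl (j k : 'I_3) : j != k -> val (g (inr j)) != val (g (inr k)).
  by apply: contraNneq => /val_inj /(can_inj gK) [->].
have ev : val v = val (g (inl i)) by rewrite -fv fK.
exists (val (g (inr ord0))), (val (g (inr (@Ordinal 3 1 isT)))),
  (val (g (inr (@Ordinal 3 2 isT)))).
by rewrite /claw_at ev !gA /= !nl.
Qed.

Theorem theorem1p2 (G : sgraph) (hconn : connected G)
    (hcrown : free crown G) (hfork : free fork G)
    (Q : {set G}) (hQ : isomorphic (induced Q) claw)
    (v : induced Q) (hv : degree v = 3) :
  perfect (induced (nonneighbors (val v))).
Proof.
have [a [b [c cl]]] := claw_centre hQ hv.
move=> X; pose g (x : induced X) : G := val (val x).
apply: (@chromatic_clique_tight _ _ g) => //; first by move=> x y /val_inj /val_inj.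
apply: contraT => /critical_exists[H HX cH].
have HM : H \subset nonneighbors (val v).
  apply: subset_trans HX _; apply/subsetP=> _ /imsetP[x _ ->].
  exact: (valP (val x)).
have nofork := free_fork hfork; have nocrown := free_crown hcrown.
have [x xH nfx] := critical_not_far nofork hconn cl cH.
have := subsetP HM x xH; rewrite !inE negb_or => /andP[nvx xv].
move: nfx; rewrite /far xv nvx negb_forall => /existsP[t].
rewrite negb_imply negbK => /andP[vt tx].
by case: (near_contradiction nofork nocrown cl cH HM vt xH tx).
Qed.
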